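(* Let $1<\beta<2$, let $\alpha\in S$, and let $R=R_{\beta,\alpha}$. Let $b=b_1b_2\cdots\in\{0,1\}^{\mathbb N}$. Then $b\in\Sigma_R$ if and only if for all $n\ge 1$ the following holds: if $b_n=1$, then $b(M^-)\preceq b_nb_{n+1}\cdots\prec d(\alpha)$; and if $b_n=0$, then $b(\alpha)\preceq b_nb_{n+1}\cdots\preceq b(M^+)$.
   Context: For $1<\beta<2$ put $M^-=\frac{-\beta}{\beta^2-1}$, $M^+=\frac{1}{\beta^2-1}$, and $S=\big[\frac{1}{\beta^2-1}-\frac1\beta,\,-\frac{1}{\beta(\beta^2-1)}\big]\subset[M^-,M^+]$. For $\alpha\in S$ define $L=L_{\beta,\alpha}$ and $R=R_{\beta,\alpha}$, both maps $[M^-,M^+]\to[M^-,M^+]$, by: $Lx=-\beta x-1$ if $x\le\alpha$ and $Lx=-\beta x$ if $x>\alpha$; $Rx=-\beta x-1$ if $x<\alpha$ and $Rx=-\beta x$ if $x\ge\alpha$. For $x\in[M^-,M^+]$ the digit sequence generated by $R$ is $b(x)=b_1(x)b_2(x)\cdots$, where for $n\ge1$, $b_n(x)=0$ if $R^{n-1}x\ge\alpha$ and $b_n(x)=1$ if $R^{n-1}x<\alpha$. $\Sigma_R=\{b(x):x\in[M^-,M^+]\}$ is the set of all digit sequences generated by $R$. Define maps $L_n$ by alternating $L$ and $R$: $L_0=\mathrm{id}$, $L_1=L$, and for $n\ge1$, $L_{2n}=(R\circ L)^n$, $L_{2n+1}=L\circ(R\circ L)^n$. For $x\in[M^-,M^+]$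 let $d(x)=d_1(x)d_2(x)\cdots$, where for $n\ge1$: $d_{2n-1}(x)=1$ if $L_{2n-2}x\le\alpha$ and $d_{2n-1}(x)=0$ if $L_{2n-2}x>\alpha$; $d_{2n}(x)=1$ if $L_{2n-1}x<\alpha$ and $d_{2n}(x)=0$ if $L_{2n-1}x\ge\alpha$. Alternate ordering on $\{0,1\}^{\mathbb N}$: $b_1b_2\cdots\prec d_1d_2\cdots$ if and only if there is an $n\ge1$ such that $b_k=d_k$ for all $1\le k\le n-1$ and $(-1)^n(b_n-d_n)<0$; and $b\preceq d$ means $b=d$ or $b\prec d$.
   Formalization: The printed interval S has its endpoints in decreasing order and is empty for every 1<β<2; the formal statement takes S = [-1/(β(β²-1)), 1/(β²-1) - 1/β], exactly the α for which L and R map [M^-,M^+] into itself. *)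

(* Defs.v *)
From mathcomp Require Import all_boot all_order all_algebra.
From mathcomp Require Import all_classical reals.
From mathcomp Require Import ring lra.

Set Implicit Arguments.
Unset Strict Implicit.
Unset Printing Implicit Defensive.

Import Order.TTheory GRing.Theory Num.Theory.

Local Open Scope classical_set_scope.
Local Open Scope ring_scope.

(* An element b_1 b_2 ... of {0,1}^N is a function nat -> bool with 0-based
   positions: b_n is the value at n.-1, and true is the digit 1. *)
Definition digit_seq := nat -> bool.

(* shift n b is b_(n+1) b_(n+2) ... *)
Definition shift (n : nat) (b : digit_seq) : digit_seq := fun k => b (n + k)%N.

(* The sign is (-1)^(n+1) because position n holds the (n+1)-st digit; in
   particular 1... comes before 0... *)
Definition alt_lt (b d : digit_seq) : Prop :=
  exists n : nat, (forall k : nat, (k < n)%N -> b k = d k) /\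
    (-1) ^+ n.+1 * ((b n : nat)%:Z - (d n : nat)%:Z) < 0.

Definition alt_le (b d : digit_seq) : Prop := b = d \/ alt_lt b d.

Section Transformations.
Variables (K : realType) (beta alpha : K).

Definition Mminus : K := - beta / (beta ^+ 2 - 1).
Definition Mplus : K := 1 / (beta ^+ 2 - 1).

(* The endpoints in increasing order: for 1 < beta < 2 it is
   - 1 / (beta (beta^2 - 1)) that is the smaller one. This is exactly the set
   of alpha for which the two maps below preserve [Mminus, Mplus]. *)
Definition param_itv : interval K :=
  `[- (1 / (beta * (beta ^+ 2 - 1))), 1 / (beta ^+ 2 - 1) - 1 / beta].

(* The maps are extended to K by the same formulas; they are only iterated from
   points of [Mminus, Mplus], which they preserve (Lmap_itv, Rmap_itv). *)
Definition Lmap (x : K) : K :=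
  if x <= alpha then - beta * x - 1 else - beta * x.

Definition Rmap (x : K) : K :=
  if x < alpha then - beta * x - 1 else - beta * x.

Definition digits (x : K) : digit_seq := fun n => iter n Rmap x < alpha.

Definition SigmaR : set digit_seq :=
  [set digits x | x in `[Mminus, Mplus]%classic].

Definition Lalt (n : nat) : K -> K :=
  if odd n then Lmap \o iter n./2 (Rmap \o Lmap) else iter n./2 (Rmap \o Lmap).

(* Position k holds the (k+1)-st digit, so the odd-indexed digits, which use
   the non-strict comparison, sit at even k. *)
Definition alt_digits (x : K) : digit_seq := fun k =>
  if odd k then Lalt k x < alpha else Lalt k x <= alpha.

Lemma param_itvP : 1 < beta -> alpha \in param_itv ->
  - beta * alpha <= Mplus /\ Mminus <= - beta * alpha - 1.
Proof.
move=> b1; rewrite in_itv /= /Mminus /Mplus => /andP[lo hi].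
have b0 : 0 < beta by lra.
have c0 : 0 < beta ^+ 2 - 1 by nra.
have bN0 : beta != 0 by rewrite gt_eqF.
have cN0 : beta ^+ 2 - 1 != 0 by rewrite gt_eqF.
split.
  have -> : 1 / (beta ^+ 2 - 1) = - beta * - (1 / (beta * (beta ^+ 2 - 1))).
    by field; rewrite bN0 cN0.
  by rewrite ler_wnM2l // oppr_le0 ltW.
have -> : - beta / (beta ^+ 2 - 1) =
          - beta * (1 / (beta ^+ 2 - 1) - 1 / beta) - 1.
  by field; rewrite bN0 cN0.
by rewrite lerD2r ler_wnM2l // oppr_le0 ltW.
Qed.

Let Mends : 1 < beta ->
  - beta * Mminus - 1 = Mplus /\ - beta * Mplus = Mminus.
Proof.
move=> b1; have cN0 : beta ^+ 2 - 1 != 0 by rewrite gt_eqF //; nra.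
by split; rewrite /Mminus /Mplus; field.
Qed.

Lemma Lmap_itv (x : K) : 1 < beta -> alpha \in param_itv ->
  x \in `[Mminus, Mplus] -> Lmap x \in `[Mminus, Mplus].
Proof.
move=> b1 /(param_itvP b1)[u v]; have [e1 e2] := Mends b1.
rewrite !in_itv /= /Lmap => /andP[lo hi].
by case: (leP x alpha) => xa; apply/andP; split; nra.
Qed.

Lemma Rmap_itv (x : K) : 1 < beta -> alpha \in param_itv ->
  x \in `[Mminus, Mplus] -> Rmap x \in `[Mminus, Mplus].
Proof.
move=> b1 /(param_itvP b1)[u v]; have [e1 e2] := Mends b1.
rewrite !in_itv /= /Rmap => /andP[lo hi].
by case: (ltP x alpha) => xa; apply/andP; split; nra.
Qed.

End Transformations.

(* Main.v *)
From mathcomp Require Import all_boot all_order all_algebra.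
From mathcomp Require Import all_classical reals topology normedtype sequences.
From mathcomp Require Import ring lra.
Require Import Defs.

(** The recurrence x_(n+1) = - beta x_n - b_n, solved within the bounded
    interval [M^-, M^+], ties a digit sequence b to a unique real sequence: the
    explicit solution is x_n = sum_k b_(n+k) (- beta)^(-k-1), and any two
    solutions coincide because their difference is multiplied by - beta at
    each step while staying bounded (expansion_exists, expansion_inj). Both the
    orbits of R with the digits b(x) and the alternating L/R orbits with the
    digits d(x) are such solutions.

    Two solutions whose digits agree before position n satisfy
    x_n - y_n = (- beta)^n (x_0 - y_0), and the alternate order is designed to
    absorb the sign (-1)^n. Hence x < y implies that b(x) precedes b(y)
    strictly, and also that it precedes d(y) strictly, d(y) being the limit of
    b(x) as x increases to y. Applied to the points R^n x, this shows that
    every sequence in Sigma_R satisfies the conditions.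

    Conversely, let x be the solution attached to an admissible b. What is to
    be shown is that b_n = 1 exactly when x_n < alpha, for then x is the
    R-orbit of x_0. Let D >= 0 bound how far any x_n lies on the wrong side of
    alpha. Comparing the tail of b at n with b(alpha) or d(alpha), whose digits
    are correct, the sequences agree at first and differ at a later position
    k >= 1, where x_(n+k) is at most D out of order with the orbit of alpha;
    going back to n divides this error by beta^k. So D may be replaced by
    D / beta, and the least such D is 0 (admissible_threshold). The strict
    inequality for b_n = 1 comes from the strict comparison with d(alpha)
    (threshold_strict). *)

Set Implicit Arguments.
Unset Strict Implicit.
Unset Printing Implicit Defensive.

Import Order.TTheory GRing.Theory Num.Theory.
Import numFieldNormedType.Exports.

Local Open Scope ring_scope.

(** * Contraction and the alternate order *)

(** The supremum s of e, if positive, would satisfy s <= c s < s. Applied to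
    distances along orbits, this replaces iterating an estimate and letting the
    number of steps go to infinity. *)
Lemma contracting_seq_le0 (K : realType) (c C : K) (e : nat -> K) :
  c < 1 -> (forall n, e n <= C) ->
  (forall D, 0 <= D -> (forall n, e n <= D) -> forall n, e n <= c * D) ->
  forall n, e n <= 0.
Proof.
move=> c1 eC contr n; rewrite leNgt; apply/negP => en.
pose s := sup (range e).
have es m : e m <= s by apply: ub_le_sup; [exists C => _ [k _ <-]|exists m].
have s0 : 0 < s := lt_le_trans en (es n).
have : s <= c * s.
  apply: ge_sup; first by exists (e n), n.
  by move=> _ [k _ <-]; apply: contr => //; exact: ltW.
by nra.
Qed.

(** The sign condition pins down both digits at the first difference, by the
    parity of its position. *)
Lemma alt_ltP (b d : digit_seq) : alt_lt b d <->
  exists n, [/\ forall k, (k < n)%N -> b k = d k, b n = ~~ odd n & d n = odd n].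
Proof.
split=> -[n].
  move=> [agree sgn]; exists n; move: sgn; rewrite exprS -signr_odd.
  by case: (odd n); case: (b n); case: (d n); split.
move=> [agree bn dn]; exists n; split=> //.
by rewrite bn dn exprS -signr_odd; case: (odd n).
Qed.

(** * Expansions in base - beta *)

Section Expansions.
Variables (K : realType) (beta : K).
Hypothesis hbeta : 1 < beta.

Local Notation Mm := (Mminus beta).
Local Notation Mp := (Mplus beta).

Let beta_gt0 : 0 < beta. Proof. exact: lt_trans ltr01 hbeta. Qed.

Let invb_gt0 : 0 < beta^-1. Proof. by rewrite invr_gt0. Qed.

Let invb_lt1 : beta^-1 < 1. Proof. by rewrite invf_lt1. Qed.

Let Mends : - beta * Mm - 1 = Mp /\ - beta * Mp = Mm.
Proof.
have cN0 : beta ^+ 2 - 1 != 0 by rewrite gt_eqF //; have := hbeta; nra.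
by split; rewrite /Mminus /Mplus; field.
Qed.

(** Equivalently x_0 = sum_k b_k (- beta)^(-k-1), and x_n is the value of the
    n-th tail of b; the recurrence lets orbits of L and R be treated as
    expansions without summing a series. *)
Definition expansion (b : digit_seq) (x : nat -> K) := forall n,
  (Mm <= x n <= Mp) /\ x n.+1 = - beta * x n - (b n)%:R.

Lemma expansion_shift b x m :
  expansion b x -> expansion (shift m b) (fun n => x (m + n)%N).
Proof. by move=> bx n; rewrite addnS; exact: bx. Qed.

(** Boundedness by any constant suffices: the affine maps x |-> - beta x - b_n
    send points outside [M^-, M^+] farther away by a factor at least beta, so
    the distance to the interval would grow without bound. *)
Lemma expansion_bounds (b : digit_seq) (x : nat -> K) (C : K) :
  (forall n, `|x n| <= C) -> (forall n, x n.+1 = - beta * x n - (b n)%:R) ->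
  expansion b x.
Proof.
move=> xC rec; have [e1 e2] := Mends.
pose e n := Num.max (Mm - x n) (x n - Mp).
have e0 : forall n, e n <= 0.
  apply: (@contracting_seq_le0 _ beta^-1 (C + `|Mm| + `|Mp|)).
  - exact: invb_lt1.
  - move=> n; rewrite /e ge_max.
    have := xC n; rewrite ler_norml => /andP[].
    have := ler_norm Mm; have := ler_norm (- Mp); rewrite normrN.
    have := normr_ge0 Mm; have := normr_ge0 Mp.
    by move=> *; apply/andP; split; lra.
  - move=> D D0 eD n; have := eD n.+1; rewrite /e !ge_max rec => /andP[h1 h2].
    have [bn0 bn1] : 0 <= (b n)%:R :> K /\ (b n)%:R <= 1 :> K.
      by case: (b n); rewrite /= ?lexx ?ler01.
    by rewrite !ler_pdivlMl//; apply/andP; split; lra.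
move=> n; split=> //; have := e0 n; rewrite /e ge_max => /andP[h1 h2].
by apply/andP; split; lra.
Qed.

(** The series sum_k b_(n+k) q^(k+1) with q = - 1/beta is dominated by a
    geometric one, uniformly in n. *)
Lemma expansion_exists (b : digit_seq) : exists x, expansion b x.
Proof.
pose q : K := - beta^-1.
have q1 : `|q| < 1 by rewrite normrN gtr0_norm ?invr_gt0// invf_lt1.
pose u n k : K := (b (n + k)%N)%:R * q ^+ k.+1.
have uq n k : `|u n k| <= geometric `|q| `|q| k.
  rewrite /geometric /= -exprS normrM normrX ler_piMl ?exprn_ge0 ?normr_ge0//.
  by case: (b _); rewrite ?normr1 ?normr0.
have gcvg : cvgn (series (geometric `|q| `|q|)).
  by apply: is_cvg_geometric_series; rewrite normr_id.
have ncvg n : cvgn [normed series (u n)].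
  apply: series_le_cvg gcvg => k; [exact: normr_ge0| |exact: uq].
  exact: le_trans (uq n k).
pose x n := limn (series (u n)).
exists x; apply: (@expansion_bounds _ _ (limn (series (geometric `|q| `|q|)))).
  move=> n; apply: le_trans (lim_series_norm (ncvg n)) _.
  exact: lim_series_le (ncvg n) gcvg (uq n).
move=> n; have ucvg m : (series (u m) @ \oo --> x m)%classic.
  exact: normed_cvg (ncvg m).
(* Dropping the leading term and multiplying by - beta shifts the series. *)
have -> : - beta * x n - (b n)%:R = - beta * (x n - u n 0%N).
  by rewrite /u addn0 expr1 /q; field; rewrite gt_eqF.
apply: (@cvg_unique _ (@norm_hausdorff _ K^o) _ _ _ _ (ucvg n.+1)).
have -> : series (u n.+1) = fun m => - beta * (series (u n) m.+1 - u n 0%N).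
  apply/funext => m.
  rewrite /series /= big_nat_recl// addrC addKr big_distrr /=.
  apply: eq_bigr => k _; rewrite /u addnS addSn [q ^+ k.+2]exprS /q.
  by field; rewrite gt_eqF.
apply: cvgM; first exact: cvg_cst.
apply: cvgB; last exact: cvg_cst.
by rewrite cvg_shiftS; exact: ucvg.
Qed.

Lemma expansion_diff b d x y n : expansion b x -> expansion d y ->
  (forall k, (k < n)%N -> b k = d k) ->
  x n - y n = (- beta) ^+ n * (x 0%N - y 0%N).
Proof.
move=> bx dy; elim: n => [|n IHn] agree; first by rewrite expr0 mul1r.
rewrite (bx n).2 (dy n).2 agree // exprS -mulrA -IHn => [|k kn].
  by ring.
exact: agree (ltnW kn).
Qed.

Lemma expansion_inj b x y :
  expansion b x -> expansion b y -> forall n, x n = y n.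
Proof.
move=> bx bx' n; apply/eqP; rewrite -subr_eq0 -normr_le0; move: n.
apply: (@contracting_seq_le0 _ beta^-1 (Mp - Mm)).
- exact: invb_lt1.
- move=> n; have [/andP[? ?] _] := bx n; have [/andP[? ?] _] := bx' n.
  by rewrite ler_norml; apply/andP; split; lra.
- move=> D D0 xyD n; have := xyD n.+1.
  rewrite ler_pdivlMl// (bx n).2 (bx' n).2.
  have -> : - beta * x n - (b n)%:R - (- beta * y n - (b n)%:R) =
    - beta * (x n - y n) by ring.
  by rewrite normrM normrN (gtr0_norm beta_gt0).
Qed.

(** The digit hypothesis asks for monotone digits only at indices of the given
    parity and in the order that x_n and y_n have there when all earlier digits
    agree; this covers R-orbits against each other as well as against the
    alternating orbits, whose digits use <= at even indices. Uniqueness of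
    expansions guarantees that a first difference exists. *)
Lemma alt_lt_of_lt b d x y : expansion b x -> expansion d y -> x 0%N < y 0%N ->
  (forall n, if odd n then y n < x n -> b n -> d n
             else x n < y n -> d n -> b n) ->
  alt_lt b d.
Proof.
move=> bx dy xy mono; apply/alt_ltP.
have [neq|same] := pselect (exists n, b n != d n); last first.
  have bd : b = d.
    apply/funext => n; apply/eqP/negPn/negP => bdn; apply: same; by exists n.
  by move: xy; rewrite bd in bx *; rewrite (expansion_inj bx dy) ltxx.
exists (ex_minn neq); case: ex_minnP => n bdn nmin.
have agree k : (k < n)%N -> b k = d k.
  by move=> kn; apply/eqP; apply: contraTT kn => /nmin; rewrite -leqNgt.
have pos : 0 < beta ^+ n by rewrite exprn_gt0.
have := expansion_diff bx dy agree; rewrite exprNn -signr_odd.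
have := mono n; case: (odd n) bdn => /=; rewrite ?expr0 ?expr1 => bdn mn dxy.
  have lt : y n < x n by nra.
  by move: (mn lt) bdn; case: (b n); case: (d n) => // /(_ isT).
have lt : x n < y n by nra.
by move: (mn lt) bdn; case: (b n); case: (d n) => // /(_ isT).
Qed.

(** At the first difference the alternate order predicts which of the two orbits
    carries the digit 1, so that the multiple beta^n (x_0 - y_0) of the initial
    gap is a difference of a point with digit 1 and a point with digit 0. *)
Lemma alt_lt_gap b d x y : expansion b x -> expansion d y -> alt_lt b d ->
  exists n, [/\ b n = ~~ odd n, d n = odd n, b 0%N = d 0%N -> (0 < n)%N &
    beta ^+ n * (x 0%N - y 0%N) = if odd n then y n - x n else x n - y n].
Proof.
move=> bx dy /alt_ltP[n [agree bn dn]]; exists n; split=> //.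
  by case: n bn dn {agree} => //= -> ->.
have := expansion_diff bx dy agree; rewrite exprNn -signr_odd.
by case: (odd n); rewrite ?expr0 ?expr1 => dxy; lra.
Qed.

(** * Digits decided by the threshold alpha *)

Section Threshold.
Variable alpha : K.

(** The digits of b are those of a threshold coding of x at alpha, up to an
    error D; for D = 0 both digits are tolerated at alpha itself, which makes
    the notion common to L and R. *)
Definition threshold_slack (D : K) (b : digit_seq) (x : nat -> K) :=
  forall n, if b n then x n <= alpha + D else alpha - D <= x n.

(** The common first digit forces the first difference to occur at some n >= 1,
    where the points are out of order by at most D + E; the gap at 0 is smaller
    by a factor beta^n >= beta. *)
Lemma slack_contracts D E b d x y : expansion b x -> expansion d y ->
  0 <= D + E -> threshold_slack D b x -> threshold_slack E d y ->
  b 0%N = d 0%N -> alt_le b d -> x 0%N - y 0%N <= beta^-1 * (D + E).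
Proof.
move=> bx dy DE0 xD yE bd0 lebd.
rewrite ler_pdivlMl//.
case: lebd => [bd|/(alt_lt_gap bx dy)[n [bn dn /(_ bd0) n0 gap]]].
  by rewrite -bd in dy; rewrite (expansion_inj bx dy) subrr mulr0.
have [xy|xy] := leP (x 0%N - y 0%N) 0.
  by apply: le_trans DE0; rewrite mulr_ge0_le0// ltW.
apply: (@le_trans _ _ (beta ^+ n * (x 0%N - y 0%N))).
  by rewrite ler_pM2r// ler_eXnr// ltW.
rewrite gap; have := xD n; have := yE n; rewrite bn dn.
by case: (odd n) => /= *; lra.
Qed.

(** The strict conditions on y are those met by the alternating orbit: at the
    first difference x_n lies weakly on one side of alpha and y_n strictly on
    the other. *)
Lemma threshold_strict b d x y : expansion b x -> expansion d y ->
  threshold_slack 0 b x ->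
  (forall n, if odd n then d n -> y n < alpha else ~~ d n -> alpha < y n) ->
  alt_lt b d -> x 0%N < y 0%N.
Proof.
move=> bx dy xs ys /(alt_lt_gap bx dy)[n [bn dn _ gap]].
have pos : 0 < beta ^+ n by rewrite exprn_gt0.
rewrite -subr_lt0 -(pmulr_rlt0 _ pos) gap.
have := xs n; have := ys n; rewrite bn dn.
by case: (odd n) => /= /(_ isT) *; lra.
Qed.

Hypothesis halpha : alpha \in param_itv beta.

Lemma expansion_digits x : x \in `[Mm, Mp] ->
  expansion (digits beta alpha x) (fun n => iter n (Rmap beta alpha) x).
Proof.
move=> xM n; split.
  rewrite -[_ && _]/(_ \in `[_, _]); elim: n => //= n; exact: Rmap_itv.
by rewrite iterS /digits /Rmap; case: ifP => _; rewrite ?subr0.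
Qed.

Lemma LaltS n x : Lalt beta alpha n.+1 x =
  (if odd n then Rmap beta alpha else Lmap beta alpha) (Lalt beta alpha n x).
Proof. by rewrite /Lalt /= uphalf_half; case: (odd n). Qed.

Lemma expansion_alt_digits x : x \in `[Mm, Mp] ->
  expansion (alt_digits beta alpha x) (fun n => Lalt beta alpha n x).
Proof.
move=> xM n; split.
  rewrite -[_ && _]/(_ \in `[_, _]); elim: n => // n; rewrite LaltS.
  by case: (odd n); [exact: Rmap_itv|exact: Lmap_itv].
rewrite LaltS /alt_digits /Rmap /Lmap.
by case: (odd n); case: ifP => _; rewrite ?subr0.
Qed.

Lemma digits_lt x y : x \in `[Mm, Mp] -> y \in `[Mm, Mp] -> x < y ->
  alt_lt (digits beta alpha x) (digits beta alpha y).
Proof.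
move=> xM yM xy.
apply: alt_lt_of_lt (expansion_digits xM) (expansion_digits yM) xy _ => n.
by case: (odd n); rewrite /digits; exact: lt_trans.
Qed.

Lemma digits_le x y : x \in `[Mm, Mp] -> y \in `[Mm, Mp] -> x <= y ->
  alt_le (digits beta alpha x) (digits beta alpha y).
Proof.
move=> xM yM; rewrite le_eqVlt => /predU1P[->|xy]; first by left.
by right; exact: digits_lt.
Qed.

Lemma digits_lt_alt_digits x y : x \in `[Mm, Mp] -> y \in `[Mm, Mp] -> x < y ->
  alt_lt (digits beta alpha x) (alt_digits beta alpha y).
Proof.
move=> xM yM xy.
apply: alt_lt_of_lt (expansion_digits xM) (expansion_alt_digits yM) xy _ => n.
rewrite /digits /alt_digits; case: (odd n); first exact: lt_trans.
exact: lt_le_trans.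
Qed.

Lemma shift_digits n x :
  shift n (digits beta alpha x) =
  digits beta alpha (iter n (Rmap beta alpha) x).
Proof. by apply/funext => k; rewrite /shift /digits addnC iterD. Qed.

Lemma param_itv_sub : alpha \in `[Mm, Mp].
Proof.
have [u v] := param_itvP hbeta halpha; have [e1 e2] := Mends.
by rewrite in_itv /=; apply/andP; split; rewrite -(ler_pM2l beta_gt0); lra.
Qed.

Lemma digits_eq b x : expansion b x -> (forall n, b n = (x n < alpha)) ->
  digits beta alpha (x 0%N) = b.
Proof.
move=> bx bE.
have xR n : iter n (Rmap beta alpha) (x 0%N) = x n.
  elim: n => // n IHn; rewrite iterS IHn (bx n).2 /Rmap bE.
  by case: ifP => _; rewrite ?subr0.
by apply/funext => n; rewrite /digits xR bE.
Qed.

(** The quantity e_n below is the signed distance by which x_n lies on the wrong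
    side of alpha; comparing the n-th tail with the codings of alpha turns a
    bound D on e into the bound D / beta. *)
Lemma admissible_threshold b x : expansion b x ->
  (forall n, if b n then alt_lt (shift n b) (alt_digits beta alpha alpha)
             else alt_le (digits beta alpha alpha) (shift n b)) ->
  threshold_slack 0 b x.
Proof.
move=> bx adm; have aM := param_itv_sub.
have Rexp := expansion_digits aM; have Lexp := expansion_alt_digits aM.
have Rslack : threshold_slack 0 (digits beta alpha alpha)
    (fun n => iter n (Rmap beta alpha) alpha).
  by move=> n; rewrite /digits addr0 subr0; case: ltP => // /ltW.
have Lslack : threshold_slack 0 (alt_digits beta alpha alpha)
    (fun n => Lalt beta alpha n alpha).
  move=> n; rewrite /alt_digits addr0 subr0; case: (odd n).
    by case: ltP => // /ltW.
  by case: leP => // /ltW.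
pose e n := if b n then x n - alpha else alpha - x n.
suff e0 n : e n <= 0.
  by move=> n; have := e0 n; rewrite /e; case: (b n) => ?; lra.
move: n; apply: (@contracting_seq_le0 _ beta^-1 (Mp - Mm)).
- exact: invb_lt1.
- move=> n; have [/andP[? ?] _] := bx n.
  by move: aM; rewrite in_itv /e /= => /andP[? ?]; case: (b n); lra.
- move=> D D0 eD n.
  have xslack : threshold_slack D (shift n b) (fun k => x (n + k)%N).
    move=> k; have := eD (n + k)%N; rewrite /e /shift.
    by case: (b _) => ?; lra.
  have bxn := expansion_shift n bx.
  have := adm n; rewrite /e; case: ifP => bn cmp.
    have := @slack_contracts D 0 _ _ _ _ bxn Lexp.
    rewrite /= addr0 addn0; apply=> //; last by right.
    by rewrite /shift addn0 bn /alt_digits /= lexx.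
  have := @slack_contracts 0 D _ _ _ _ Rexp bxn.
  rewrite /= add0r addn0; apply=> //.
  by rewrite /shift addn0 bn /digits /= ltxx.
Qed.

(** A digit 0 already gives alpha <= x_n, as R requires; only for the digit 1
    must equality with alpha be excluded. *)
Lemma admissible_digits b x : expansion b x ->
  (forall n, if b n then alt_lt (shift n b) (alt_digits beta alpha alpha)
             else alt_le (digits beta alpha alpha) (shift n b)) ->
  digits beta alpha (x 0%N) = b.
Proof.
move=> bx adm; have slack := admissible_threshold bx adm.
apply: digits_eq => // n; have := adm n; have := slack n.
case: (b n) => [_ cmp|]; last by rewrite subr0 leNgt => /negbTE->.
have := @threshold_strict _ _ _ _ (expansion_shift n bx)
  (expansion_alt_digits param_itv_sub).
rewrite addn0 => -> // k; first exact: slack.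
by rewrite /alt_digits; case: (odd k); rewrite // -ltNge.
Qed.

End Threshold.
End Expansions.

Theorem theorem3p1 (K : realType) (beta alpha : K)
    (hbeta : 1 < beta < 2) (halpha : alpha \in param_itv beta)
    (b : digit_seq) :
  SigmaR beta alpha b <->
  (forall n : nat,
     (b n = true ->
        alt_le (digits beta alpha (Mminus beta)) (shift n b) /\
        alt_lt (shift n b) (alt_digits beta alpha alpha)) /\
     (b n = false ->
        alt_le (digits beta alpha alpha) (shift n b) /\
        alt_le (shift n b) (digits beta alpha (Mplus beta)))).
Proof.
have /andP[b1 _] := hbeta.
have aM := param_itv_sub b1 halpha.
have le_M : Mminus beta <= Mplus beta.
  by move: aM; rewrite in_itv /= => /andP[]; exact: le_trans.
have [mM pM] : Mminus beta \in `[Mminus beta, Mplus beta] /\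
    Mplus beta \in `[Mminus beta, Mplus beta].
  by rewrite !in_itv /= !lexx !le_M.
split=> [[x xM <-] n|adm].
  rewrite shift_digits; have [itv _] := expansion_digits b1 halpha xM n.
  have xnM : iter n (Rmap beta alpha) x \in `[Mminus beta, Mplus beta].
    by rewrite in_itv.
  have /andP[lo hi] := itv.
  split=> [xa|/negbT].
    by split; [exact: digits_le|exact: digits_lt_alt_digits].
  by rewrite -leNgt => ax; split; exact: digits_le.
have [x bx] := expansion_exists b1 b.
exists (x 0%N); first by rewrite /= in_itv; exact: (bx 0%N).1.
apply: admissible_digits => // n.
have := adm n; case: (b n) => -[h1 h2]; first exact: (h1 erefl).2.
exact: (h2 erefl).1.
Qed.
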